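(* Let $\gamma(s)=(x(s),y(s))$ be a conformal soliton of the inverse curve shortening flow in $\mathbb{H}^2$, i.e. the first two components of the maximal solution $(x(s),y(s),\theta(s))$ of $$x'=\cos\theta,\qquad y'=\sin\theta,\qquad \theta'=-\frac{1}{\cos\theta}-\frac{\cos\theta}{y}$$ with initial conditions $(x(0),y(0),\theta(0))=(0,y_0,\theta(0))$, where $y_0>0$ and $0<\theta(0)<\pi/2$. Then $\gamma$ can be reparametrized (by a translation of the parameter) so that $\theta(0)=0$. In consequence, $\gamma$ is a concave graph on the $x$-axis over some bounded interval $(x_m,x_M)$, where the limits of the tangents at the endpoints are vertical.
   Context: $\mathbb{H}^2$ is the upper half-plane $\{(x,y)\in\mathbb{R}^2: y>0\}$ with metric $(dx^2+dy^2)/y^2$. For a regular curve $\gamma=(x,y)$, the unit normal is $N=y\,(-y',x')/\sqrt{x'^2+y'^2}$ and the hyperbolic curvature is $\kappa=y\kappa_e+x'/\sqrt{x'^2+y'^2}$, where $\kappa_e=(x'y''-x''y')/(x'^2+y'^2)^{3/2}$. A conformal soliton of the inverse curve shortening flow is a curve satisfying $1/\kappa=-\langle N,\partial_y\rangle$; when $\gamma$ is parametrized by Euclidean arc length with $x'=\cos\theta$, $y'=\sin\theta$, this is equivalent to the displayed system, whose phase space is taken to be $y>0$, $\theta\in(-\pi/2,\pi/2)$. A graph on the $x$-axis is a curve of the form $y=y(x)$. *)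

(* Defs.v *)
From Stdlib Require Import Reals.
From Coquelicot Require Import Coquelicot.
Open Scope R_scope.

Definition in_oo (a b : Rbar) (s : R) : Prop := Rbar_lt a s /\ Rbar_lt s b.

(** The equation 1/kappa = -<N, d/dy> for a curve parametrized by Euclidean arc
    length with x' = cos th, y' = sin th: there kappa = y th' + cos th and
    <N, d/dy> = cos th / y, whence the formula for th'.  The first two
    conditions are the phase space. *)
Definition soliton_solution (a b : Rbar) (x y th : R -> R) : Prop :=
  forall s : R, in_oo a b s ->
    0 < y s /\
    - (PI / 2) < th s < PI / 2 /\
    is_derive x s (cos (th s)) /\
    is_derive y s (sin (th s)) /\
    is_derive th s (- (1 / cos (th s)) - cos (th s) / y s).

(** The values of the functions outside (a, b) are irrelevant. *)
Definition maximal_soliton_solution (a b : Rbar) (x y th : R -> R) : Prop :=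
  soliton_solution a b x y th /\
  forall (a1 b1 : Rbar) (x1 y1 th1 : R -> R),
    Rbar_le a1 a -> Rbar_le b b1 ->
    soliton_solution a1 b1 x1 y1 th1 ->
    (forall s : R, in_oo a b s -> x1 s = x s /\ y1 s = y s /\ th1 s = th s) ->
    a1 = a /\ b1 = b.

Definition trace (a b : Rbar) (x y : R -> R) (p : R * R) : Prop :=
  exists s : R, in_oo a b s /\ p = (x s, y s).

Definition is_graph_over (xm xM : R) (f : R -> R) (C : R * R -> Prop) : Prop :=
  forall p q : R, C (p, q) <-> (xm < p < xM /\ q = f p).

Definition concave_on (xm xM : R) (f : R -> R) : Prop :=
  forall p q t : R, xm < p < xM -> xm < q < xM -> 0 <= t <= 1 ->
    t * f p + (1 - t) * f q <= f (t * p + (1 - t) * q).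

Definition tangent (x y : R -> R) (s : R) : R * R := (Derive x s, Derive y s).

Definition vertical (v : R * R) : Prop := fst v = 0 /\ snd v <> 0.

(** For e = a or e = b: the one-sided limit at that end, also when e is infinite. *)
Definition tangent_limit_at_end (a b e : Rbar) (x y : R -> R) (v : R * R) : Prop :=
  filterlim (tangent x y) (within (in_oo a b) (Rbar_locally e)) (locally v).

(* Main.v *)
Require Import Defs.
From Stdlib Require Import Reals Ranalysis5 Lra.
From Coquelicot Require Import Coquelicot.
Open Scope R_scope.

(** [(cos(theta)^2 + 2 y) / y^2] is a first integral of the system.  If [c > 0] is
    its value and [u = - theta], then [y = (1 + w) / c] and [u' = w / cos u] with
    [w = sqrt (1 + c cos(u)^2)], so that [s] and [x] are the integrals of
    [cos u / w] and [cos(u)^2 / w] in [u].  These integrals and [y] are defined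
    for all [u] and trace out a solution as [u] runs over [(-pi/2, pi/2)]; it
    extends every other one with the same initial data, so the maximal solution
    takes each angle exactly once, in finite time and over a bounded
    [x]-interval.  Concavity holds because [w > 0] makes the curve stay below
    each of its tangent lines. *)

(** * Intervals with extended endpoints, mean value arguments and inverse functions *)

Lemma in_oo_between (a b : Rbar) (s t u : R) :
  in_oo a b s -> in_oo a b t -> s <= u <= t -> in_oo a b u.
Proof.
  intros [Hs _] [_ Ht] [Hsu Hut]; split.
  - destruct a; simpl in *; trivial; lra.
  - destruct b; simpl in *; trivial; lra.
Qed.

(** Converts pointwise inclusion into the endpoint inequalities demanded by the maximality clause.
    The point [t] guards against an empty interval, for which inclusion says nothing about
    endpoints. *)
Lemma in_oo_subset (a b : Rbar) (l r t : R) :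
  in_oo a b t -> (forall s, in_oo a b s -> l < s < r) ->
  Rbar_le l a /\ Rbar_le b r.
Proof.
  intros Ht H; pose proof (H t Ht) as Hlr.
  assert (Hleft : forall s : R, Rbar_lt a s -> s <= t -> l < s).
  { intros s Hs Hst; apply H; split; trivial.
    apply (Rbar_le_lt_trans s t); [exact Hst | apply Ht]. }
  assert (Hright : forall s : R, Rbar_lt s b -> t <= s -> s < r).
  { intros s Hs Hst; apply H; split; trivial.
    apply (Rbar_lt_le_trans a t); [apply Ht | exact Hst]. }
  clear H; destruct Ht as [Hat Htb]; split.
  - destruct a as [a | |]; simpl in *; trivial.
    + destruct (Rle_or_lt l a) as [| Hal]; trivial.
      pose proof (Hleft ((a + l) / 2)); lra.
    + pose proof (Hleft (l - 1) I); lra.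
  - destruct b as [b | |]; simpl in *; trivial.
    + destruct (Rle_or_lt b r) as [| Hrb]; trivial.
      pose proof (Hright ((b + r) / 2)); lra.
    + pose proof (Hright (r + 1) I); lra.
Qed.

Lemma mean_value (a b : Rbar) (F dF : R -> R) (s t : R) :
  (forall u, in_oo a b u -> is_derive F u (dF u)) ->
  in_oo a b s -> in_oo a b t -> s < t ->
  exists u, F t - F s = dF u * (t - s) /\ s < u < t.
Proof.
  intros HF Hs Ht Hst.
  apply MVT_cor2; trivial.
  intros u Hu; apply is_derive_Reals, HF, (in_oo_between a b s t); trivial.
Qed.

Lemma constant_of_zero_derive (a b : Rbar) (F : R -> R) (s t : R) :
  (forall u, in_oo a b u -> is_derive F u 0) ->
  in_oo a b s -> in_oo a b t -> F s = F t.
Proof.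
  intros HF Hs Ht.
  destruct (Rtotal_order s t) as [H | [-> | H]]; trivial.
  - destruct (mean_value a b F (fun _ => 0) s t HF Hs Ht H) as [u [Hu _]]; lra.
  - destruct (mean_value a b F (fun _ => 0) t s HF Ht Hs H) as [u [Hu _]]; lra.
Qed.

Lemma is_derive_primitive (f : R -> R) (u0 u : R) :
  (forall v, continuous f v) -> is_derive (fun v => RInt f u0 v) u (f u).
Proof.
  intros Hf.
  apply (is_derive_RInt f _ u0); trivial.
  apply filter_forall; intros v.
  apply (@RInt_correct R_CompleteNormedModule), ex_RInt_continuous.
  intros z _; apply Hf.
Qed.

(** Positivity is asked only in the interior because the integrands of interest vanish at -pi/2 and
    pi/2; the mean value point is interior anyway, so monotonicity reaches the closed ends. *)
Lemma derive_pos_increasing (F dF : R -> R) (l r : R) :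
  (forall u, is_derive F u (dF u)) -> (forall u, l < u < r -> 0 < dF u) ->
  forall u v, l <= u -> u < v -> v <= r -> F u < F v.
Proof.
  intros HF Hpos u v Hu Huv Hv.
  destruct (mean_value m_infty p_infty F dF u v) as [w [Hw Hw']];
    try (split; exact I); trivial.
  assert (0 < dF w * (v - u)) by (apply Rmult_lt_0_compat; [apply Hpos |]; lra).
  lra.
Qed.

Lemma increasing_inverse (F dF : R -> R) (l r : R) :
  l < r ->
  (forall u, is_derive F u (dF u)) -> (forall u, l < u < r -> 0 < dF u) ->
  exists g : R -> R, forall s, F l < s < F r ->
    l < g s < r /\ F (g s) = s /\ is_derive g s (/ dF (g s)).
Proof.
  intros Hlr HF Hpos.
  pose proof (derive_pos_increasing F dF l r HF Hpos) as Hincr.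
  assert (Hlr' : F l < F r) by (apply Hincr; lra).
  assert (Hcont : continuity F).
  { intros u; apply continuity_pt_filterlim, (@ex_derive_continuous R_AbsRing R_NormedModule).
    exists (dF u); apply HF. }
  (* Clamping [s] into [[F l, F r]] gives every real a preimage by the intermediate value theorem,
     so the inverse is a total function; on the range of [F] the clamp does nothing. *)
  assert (Hiv : forall s, {u | Rmin l r <= u <= Rmax l r /\ F u = Rmax (F l) (Rmin s (F r))}).
  { intros s; apply IVT_gen; trivial.
    rewrite (Rmin_left (F l) (F r)), (Rmax_right (F l) (F r)) by lra.
    unfold Rmax, Rmin; repeat destruct Rle_dec; lra. }
  exists (fun s => proj1_sig (Hiv s)).
  assert (Hg : forall s, F l <= s <= F r ->
    l <= proj1_sig (Hiv s) <= r /\ F (proj1_sig (Hiv s)) = s).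
  { intros s Hs; destruct (Hiv s) as [u [Hu Hu']]; simpl.
    rewrite Rmin_left, Rmax_right in Hu by lra.
    rewrite Rmin_left, Rmax_right in Hu' by lra.
    split; trivial. }
  set (g := fun s => proj1_sig (Hiv s)) in *.
  change (forall s, F l <= s <= F r -> l <= g s <= r /\ F (g s) = s) in Hg.
  change (forall s, F l < s < F r -> l < g s < r /\ F (g s) = s /\ is_derive g s (/ dF (g s))).
  clearbody g; clear Hiv.
  assert (Hg' : forall s, F l < s < F r -> l < g s < r).
  { intros s Hs; destruct (Hg s ltac:(lra)) as [[[H1 | H1] [H2 | H2]] H3]; try lra.
    - rewrite H2 in H3; lra.
    - rewrite <- H1 in H3; lra. }
  intros s Hs.
  destruct (Hg s ltac:(lra)) as [_ Hs'].
  pose proof (Hg' s Hs) as Hgs.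
  split; [exact Hgs | split; [exact Hs' |]].
  assert (Hgc : continuity_pt g s).
  { apply (continuity_pt_recip_interv F g l r Hlr Hincr); trivial.
    - intros t H1 H2; apply (Hg t); lra.
    - intros t H1 H2; apply (Hg t); lra. }
  apply is_derive_Reals.
  (* An explicit derivability witness, so that [derive_pt] reduces to [dF]. *)
  pose (prF := fun (u : R) (_ : g (F l) <= u <= g (F r)) =>
    exist (fun d => derivable_pt_abs F u d) (dF u) (proj1 (is_derive_Reals F u (dF u)) (HF u))).
  assert (Hgs2 : g (F l) <= g s <= g (F r)).
  { destruct (Hg (F l) ltac:(lra)) as [H1 H2], (Hg (F r) ltac:(lra)) as [H3 H4].
    destruct (Rlt_or_le l (g (F l))) as [H | H];
      [pose proof (Hincr l (g (F l)) ltac:(lra) H ltac:(lra)); lra |].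
    destruct (Rlt_or_le (g (F r)) r) as [H' | H'];
      [pose proof (Hincr (g (F r)) r ltac:(lra) H' ltac:(lra)); lra |].
    lra. }
  replace (/ dF (g s)) with (1 / derive_pt F (g s) (prF (g s) Hgs2))
    by (unfold derive_pt; simpl; unfold Rdiv; ring).
  apply (derivable_pt_lim_recip_interv F g (F l) (F r) s); trivial.
  - intros t Ht; apply Hg; trivial.
  - simpl; apply Rgt_not_eq, Hpos, Hgs.
Qed.

(** * The explicit model solution, parametrized by the reversed angle *)

Definition speed (c u : R) : R := sqrt (1 + c * cos u ^ 2).
(** The positive root [y] of [c * y ^ 2 - 2 * y - cos u ^ 2 = 0], which is the level set [c] of the
    first integral. *)
Definition height (c u : R) : R := (1 + speed c u) / c.
(** The arc length [s] as a function of [u = - theta]; the base point [u0] is the value of [u] at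
    [s = 0]. The sign reversal makes it increasing on the phase interval. *)
Definition param (c u0 u : R) : R := RInt (fun v => cos v / speed c v) u0 u.
Definition abscissa (c u0 u : R) : R := RInt (fun v => cos v ^ 2 / speed c v) u0 u.

Lemma speed_radicand_pos (c u : R) : 0 < c -> 0 < 1 + c * cos u ^ 2.
Proof.
  intros Hc; pose proof (Rmult_le_pos c (cos u ^ 2) ltac:(lra) (pow2_ge_0 _)); lra.
Qed.

Lemma speed_pos (c u : R) : 0 < c -> 0 < speed c u.
Proof. intros Hc; apply sqrt_lt_R0, speed_radicand_pos, Hc. Qed.

Lemma height_pos (c u : R) : 0 < c -> 0 < height c u.
Proof.
  intros Hc; pose proof (speed_pos c u Hc); apply Rdiv_lt_0_compat; lra.
Qed.

Lemma speed_sqr (c u : R) : 0 < c -> speed c u * speed c u = 1 + c * cos u ^ 2.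
Proof. intros Hc; apply sqrt_sqrt, Rlt_le, speed_radicand_pos, Hc. Qed.

Lemma is_derive_height (c u : R) :
  0 < c -> is_derive (height c) u (- (sin u * cos u / speed c u)).
Proof.
  intros Hc; unfold height, speed.
  pose proof (speed_radicand_pos c u Hc).
  auto_derive; trivial.
  assert (0 < sqrt (1 + c * cos u ^ 2)) by apply (speed_pos c u Hc).
  replace (1 + c * (cos u * (cos u * 1))) with (1 + c * cos u ^ 2) by ring.
  field; lra.
Qed.

Lemma is_derive_param (c u0 u : R) :
  0 < c -> is_derive (param c u0) u (cos u / speed c u).
Proof.
  intros Hc; apply (is_derive_primitive (fun v => cos v / speed c v)); intros v.
  apply (@ex_derive_continuous R_AbsRing R_NormedModule).
  unfold speed; auto_derive; pose proof (speed_radicand_pos c v Hc).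
  repeat split; trivial; apply Rgt_not_eq, (speed_pos c v Hc).
Qed.

Lemma is_derive_abscissa (c u0 u : R) :
  0 < c -> is_derive (abscissa c u0) u (cos u ^ 2 / speed c u).
Proof.
  intros Hc; apply (is_derive_primitive (fun v => cos v ^ 2 / speed c v)); intros v.
  apply (@ex_derive_continuous R_AbsRing R_NormedModule).
  unfold speed; auto_derive; pose proof (speed_radicand_pos c v Hc).
  repeat split; trivial; apply Rgt_not_eq, (speed_pos c v Hc).
Qed.

Lemma cos_phase_pos (u : R) : - (PI / 2) < u < PI / 2 -> 0 < cos u.
Proof. intros Hu; apply cos_gt_0; lra. Qed.

Lemma param_increasing (c u0 u v : R) :
  0 < c -> - (PI / 2) <= u -> u < v -> v <= PI / 2 -> param c u0 u < param c u0 v.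
Proof.
  intros Hc; apply (derive_pos_increasing _ (fun w => cos w / speed c w)).
  - intros w; apply is_derive_param, Hc.
  - intros w Hw; apply Rdiv_lt_0_compat; [apply cos_phase_pos, Hw | apply speed_pos, Hc].
Qed.

Lemma param_injective (c u0 u v : R) :
  0 < c -> - (PI / 2) <= u <= PI / 2 -> - (PI / 2) <= v <= PI / 2 ->
  param c u0 u = param c u0 v -> u = v.
Proof.
  intros Hc Hu Hv H.
  destruct (Rtotal_order u v) as [Hlt | [Heq | Hlt]]; trivial.
  - pose proof (param_increasing c u0 u v Hc ltac:(lra) Hlt ltac:(lra)); lra.
  - pose proof (param_increasing c u0 v u Hc ltac:(lra) Hlt ltac:(lra)); lra.
Qed.

Lemma abscissa_increasing (c u0 u v : R) :
  0 < c -> - (PI / 2) <= u -> u < v -> v <= PI / 2 -> abscissa c u0 u < abscissa c u0 v.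
Proof.
  intros Hc; apply (derive_pos_increasing _ (fun w => cos w ^ 2 / speed c w)).
  - intros w; apply is_derive_abscissa, Hc.
  - intros w Hw; apply Rdiv_lt_0_compat; [apply pow_lt, cos_phase_pos, Hw | apply speed_pos, Hc].
Qed.

(* The equation for theta becomes explicit: [1 / cos + cos / y = speed / cos]. *)
Lemma height_angle_equation (c u : R) :
  0 < c -> 0 < cos u -> 1 / cos u + cos u / height c u = speed c u / cos u.
Proof.
  intros Hc Hu; pose proof (speed_sqr c u Hc); pose proof (speed_pos c u Hc).
  unfold height.
  apply (Rmult_eq_reg_r (cos u * (1 + speed c u)));
    [| apply Rgt_not_eq, Rmult_lt_0_compat; lra].
  replace ((1 / cos u + cos u / ((1 + speed c u) / c)) * (cos u * (1 + speed c u)))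
    with (1 + speed c u + c * cos u ^ 2) by (field; lra).
  replace (speed c u / cos u * (cos u * (1 + speed c u)))
    with (speed c u + speed c u * speed c u) by (field; lra).
  lra.
Qed.

(** With [g] the inverse of [param], the chain rule multiplies each derivative in [u] by
    [speed / cos], which turns those of [abscissa] and [height] into [cos u] and [- sin u]. The
    first clause serves to identify [g] with the angle of another solution. *)
Lemma model_solution (c u0 : R) : 0 < c ->
  exists g : R -> R,
    (forall s, param c u0 (- (PI / 2)) < s < param c u0 (PI / 2) ->
      - (PI / 2) < g s < PI / 2 /\ param c u0 (g s) = s) /\
    soliton_solution (param c u0 (- (PI / 2))) (param c u0 (PI / 2))
      (fun s => abscissa c u0 (g s)) (fun s => height c (g s)) (fun s => - g s).
Proof.
  intros Hc; pose proof PI_RGT_0 as HPI.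
  destruct (increasing_inverse (param c u0) (fun w => cos w / speed c w)
    (- (PI / 2)) (PI / 2)) as [g Hg].
  - lra.
  - intros u; apply is_derive_param, Hc.
  - intros u Hu; apply Rdiv_lt_0_compat; [apply cos_phase_pos, Hu | apply speed_pos, Hc].
  - exists g; split.
    + intros s Hs; split; apply (Hg s Hs).
    + intros s Hs; destruct (Hg s Hs) as (Hphase & _ & Hdg).
      pose proof (cos_phase_pos _ Hphase) as Hcos.
      pose proof (speed_pos c (g s) Hc) as Hspeed.
      repeat match goal with |- _ /\ _ => split end; try lra.
      * apply height_pos, Hc.
      * rewrite cos_neg.
        replace (cos (g s)) with (scal (/ (cos (g s) / speed c (g s))) (cos (g s) ^ 2 / speed c (g s)))
          by (unfold scal; simpl; unfold mult; simpl; field; lra).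
        apply (is_derive_comp (abscissa c u0) g); trivial.
        apply is_derive_abscissa, Hc.
      * rewrite sin_neg.
        replace (- sin (g s)) with (scal (/ (cos (g s) / speed c (g s))) (- (sin (g s) * cos (g s) / speed c (g s))))
          by (unfold scal; simpl; unfold mult; simpl; field; lra).
        apply (is_derive_comp (height c) g); trivial.
        apply is_derive_height, Hc.
      * rewrite cos_neg.
        replace (- (1 / cos (g s)) - cos (g s) / height c (g s))
          with (opp (/ (cos (g s) / speed c (g s)))).
        -- apply (is_derive_opp g); trivial.
        -- pose proof (height_angle_equation c (g s) Hc Hcos) as H.
           unfold opp; simpl.
           replace (/ (cos (g s) / speed c (g s))) with (speed c (g s) / cos (g s))
             by (field; lra).
           lra.
Qed.

(** * Conservation law and comparison of an arbitrary solution with the model *)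

Definition first_integral (y th : R -> R) (s : R) : R :=
  (cos (th s) ^ 2 + 2 * y s) / y s ^ 2.

(** The numerator [n = cos th ^ 2 + 2 * y] satisfies [n' = 2 * (y' / y) * n], so it grows exactly
    like [y ^ 2]. *)
Lemma is_derive_first_integral (a b : Rbar) (x y th : R -> R) (s : R) :
  soliton_solution a b x y th -> in_oo a b s ->
  is_derive (first_integral y th) s 0.
Proof.
  intros Hsol Hs; destruct (Hsol s Hs) as (Hy & Hphase & _ & Hdy & Hdth).
  pose proof (cos_phase_pos _ Hphase) as Hcos.
  unfold first_integral; auto_derive.
  - repeat split; try (eexists; eassumption).
    apply Rgt_not_eq; rewrite Rmult_1_r; apply Rmult_lt_0_compat; trivial.
  - replace (Derive (fun v : R => y v) s) with (sin (th s)) by (symmetry; apply is_derive_unique, Hdy).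
    replace (Derive (fun v : R => th v) s) with (- (1 / cos (th s)) - cos (th s) / y s)
      by (symmetry; apply is_derive_unique, Hdth).
    field; lra.
Qed.

Lemma first_integral_pos (y th : R -> R) (s : R) : 0 < y s -> 0 < first_integral y th s.
Proof.
  intros Hy; pose proof (pow2_ge_0 (cos (th s))).
  apply Rdiv_lt_0_compat; [lra | apply pow_lt, Hy].
Qed.

(** With [c] the value of the integral, [(c * y - 1) ^ 2 = 1 + c * cos th ^ 2]; the bound
    [1 <= c * y] selects the positive square root. *)
Lemma height_of_first_integral (y th : R -> R) (s : R) :
  0 < y s -> y s = height (first_integral y th s) (- th s).
Proof.
  intros Hy; pose proof (first_integral_pos y th s Hy) as Hc.
  unfold height, speed; rewrite cos_neg.
  set (c := first_integral y th s) in *.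
  assert (Hq : c * y s * y s = cos (th s) ^ 2 + 2 * y s)
    by (unfold c, first_integral; field; lra).
  assert (1 <= c * y s).
  { apply (Rmult_le_reg_r (y s)); trivial; pose proof (pow2_ge_0 (cos (th s))); lra. }
  replace (1 + c * cos (th s) ^ 2) with ((c * y s - 1) * (c * y s - 1)).
  - rewrite sqrt_square by lra; field; lra.
  - replace (cos (th s) ^ 2) with (c * y s * y s - 2 * y s) by lra; ring.
Qed.

(** Uniqueness by quadrature. Conservation gives [y] in terms of the angle, which closes the angle
    equation; then [param c u0 (- th s) - s] and [abscissa c u0 (- th s) - x s] have zero derivative
    and vanish at [s = 0]. *)
Lemma solution_is_model (a b : Rbar) (x y th : R -> R) (c u0 s : R) :
  soliton_solution a b x y th -> in_oo a b 0 ->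
  x 0 = 0 -> c = first_integral y th 0 -> u0 = - th 0 -> in_oo a b s ->
  y s = height c (- th s) /\ param c u0 (- th s) = s /\ abscissa c u0 (- th s) = x s.
Proof.
  intros Hsol H0 Hx Hc0 Hu0 Hs.
  assert (Hc : 0 < c) by (rewrite Hc0; apply first_integral_pos, (Hsol 0 H0)).
  assert (Hheight : forall t, in_oo a b t -> y t = height c (- th t)).
  { intros t Ht; rewrite Hc0.
    rewrite (constant_of_zero_derive a b (first_integral y th) 0 t); trivial.
    - apply height_of_first_integral, (Hsol t Ht).
    - intros u Hu; apply (is_derive_first_integral a b x); trivial. }
  assert (Hth : forall t, in_oo a b t ->
    is_derive (fun r => - th r) t (speed c (- th t) / cos (- th t))).
  { intros t Ht; destruct (Hsol t Ht) as (_ & Hphase & _ & _ & Hdth).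
    pose proof (cos_phase_pos _ Hphase) as Hcos.
    rewrite <- (height_angle_equation c (- th t)), <- Hheight, cos_neg;
      trivial; [| rewrite cos_neg; trivial].
    replace (1 / cos (th t) + cos (th t) / y t)
      with (opp (- (1 / cos (th t)) - cos (th t) / y t)) by (unfold opp; simpl; ring).
    apply (is_derive_opp th); trivial. }
  assert (Hprim : forall (P dP : R -> R), (forall u, is_derive P u (dP u)) ->
    forall t, in_oo a b t ->
    is_derive (fun r => P (- th r)) t (speed c (- th t) / cos (- th t) * dP (- th t))).
  { intros P dP HP t Ht.
    apply (is_derive_comp P (fun r => - th r)); [apply HP | apply Hth, Ht]. }
  assert (Hpos : forall t, in_oo a b t -> 0 < cos (- th t) /\ 0 < speed c (- th t)).
  { intros t Ht; rewrite cos_neg; split; [| apply speed_pos, Hc].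
    apply cos_phase_pos, (Hsol t Ht). }
  split; [apply Hheight, Hs | split].
  - enough (param c u0 (- th s) - s = param c u0 (- th 0) - 0) as H.
    { rewrite <- Hu0 in H; unfold param in H at 2; rewrite RInt_point in H; unfold zero in H; simpl in H; lra. }
    apply (constant_of_zero_derive a b (fun r => param c u0 (- th r) - r)); trivial.
    intros t Ht; destruct (Hpos t Ht).
    replace 0 with (minus (speed c (- th t) / cos (- th t) * (cos (- th t) / speed c (- th t))) one)
      by (unfold minus, plus, opp, one; simpl; field; lra).
    apply (is_derive_minus (fun r => param c u0 (- th r)) (fun r => r)).
    + apply (Hprim (param c u0) (fun u => cos u / speed c u)); trivial.
      intros u; apply is_derive_param, Hc.
    + apply (@is_derive_id R_AbsRing).
  - enough (abscissa c u0 (- th s) - x s = abscissa c u0 (- th 0) - x 0) as H.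
    { rewrite <- Hu0 in H; unfold abscissa in H at 2; rewrite RInt_point, Hx in H; unfold zero in H; simpl in H; lra. }
    apply (constant_of_zero_derive a b (fun r => abscissa c u0 (- th r) - x r)); trivial.
    intros t Ht; destruct (Hpos t Ht).
    replace 0 with (minus (speed c (- th t) / cos (- th t) * (cos (- th t) ^ 2 / speed c (- th t))) (cos (th t)))
      by (rewrite <- (cos_neg (th t)); unfold minus, plus, opp; simpl; field; lra).
    apply (is_derive_minus (fun r => abscissa c u0 (- th r)) x).
    + apply (Hprim (abscissa c u0) (fun u => cos u ^ 2 / speed c u)); trivial.
      intros u; apply is_derive_abscissa, Hc.
    + apply (Hsol t Ht).
Qed.

(** Since the angle stays in the phase interval, the parameter stays between the two values of
    [param]; the model lives on that whole interval and extends the solution, so maximality forces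
    equal endpoints. *)
Lemma maximal_solution_is_model (a b : Rbar) (x y th : R -> R) (c u0 : R) :
  maximal_soliton_solution a b x y th -> in_oo a b 0 ->
  x 0 = 0 -> c = first_integral y th 0 -> u0 = - th 0 ->
  a = param c u0 (- (PI / 2)) /\ b = param c u0 (PI / 2).
Proof.
  intros [Hsol Hmax] H0 Hx Hc' Hu0.
  assert (Hc : 0 < c) by (rewrite Hc'; apply first_integral_pos, (Hsol 0 H0)).
  destruct (model_solution c u0 Hc) as [g [Hg Hmodel]].
  assert (Hrange : forall s, in_oo a b s ->
    param c u0 (- (PI / 2)) < s < param c u0 (PI / 2)).
  { intros s Hs; destruct (Hsol s Hs) as (_ & Hphase & _).
    destruct (solution_is_model a b x y th c u0 s) as (_ & Hs' & _); trivial.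
    rewrite <- Hs'; split; apply param_increasing; lra. }
  destruct (in_oo_subset a b _ _ 0 H0 Hrange) as [Ha Hb].
  destruct (Hmax _ _ _ _ _ Ha Hb Hmodel) as [-> ->]; [| split; trivial].
  intros s Hs; pose proof (Hrange s Hs) as Hs'; destruct (Hg s Hs') as [Hphase Hgs].
  destruct (Hsol s Hs) as (_ & Hphase' & _).
  destruct (solution_is_model a b x y th c u0 s) as (Hy & Hp & Hab); trivial.
  (* Both angles have parameter value [s], and [param] is injective on the phase interval. *)
  assert (g s = - th s) as ->.
  { apply (param_injective c u0); trivial; lra. }
  rewrite Hy, Hab; repeat split; trivial; lra.
Qed.

(** * Translation of the parameter *)

Lemma in_oo_translate (a b : Rbar) (t s : R) :
  in_oo (Rbar_minus a t) (Rbar_minus b t) s <-> in_oo a b (s + t).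
Proof.
  unfold in_oo; destruct a, b; simpl; split; intros [H1 H2]; split; trivial; lra.
Qed.

Lemma soliton_solution_translate (a b : Rbar) (x y th : R -> R) (t : R) :
  soliton_solution a b x y th ->
  soliton_solution (Rbar_minus a t) (Rbar_minus b t)
    (fun s => x (s + t)) (fun s => y (s + t)) (fun s => th (s + t)).
Proof.
  intros Hsol s Hs; apply in_oo_translate in Hs.
  destruct (Hsol _ Hs) as (Hy & Hphase & Hdx & Hdy & Hdth).
  assert (Hshift : forall (F : R -> R) (d : R),
    is_derive F (s + t) d -> is_derive (fun r => F (r + t)) s d).
  { intros F d HF; rewrite <- (Rmult_1_l d).
    apply (is_derive_comp F (fun r => r + t)); trivial.
    auto_derive; trivial; ring. }
  split; [| split; [| split; [| split]]]; trivial; apply Hshift; trivial.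
Qed.

Lemma Rbar_minus_opp_le (a1 a : Rbar) (t : R) :
  Rbar_le a1 (Rbar_minus a t) -> Rbar_le (Rbar_minus a1 (- t)) a.
Proof. destruct a1, a; simpl; trivial; lra. Qed.

Lemma Rbar_le_minus_opp (b1 b : Rbar) (t : R) :
  Rbar_le (Rbar_minus b t) b1 -> Rbar_le b (Rbar_minus b1 (- t)).
Proof. destruct b1, b; simpl; trivial; lra. Qed.

Lemma Rbar_minus_opp_cancel (a1 a : Rbar) (t : R) :
  Rbar_minus a1 (- t) = a -> a1 = Rbar_minus a t.
Proof.
  intros <-; destruct a1; simpl; trivial; f_equal; ring.
Qed.

(** An extension of the translated solution, shifted back by [- t], extends the original one. *)
Lemma maximal_soliton_solution_translate (a b : Rbar) (x y th : R -> R) (t : R) :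
  maximal_soliton_solution a b x y th ->
  maximal_soliton_solution (Rbar_minus a t) (Rbar_minus b t)
    (fun s => x (s + t)) (fun s => y (s + t)) (fun s => th (s + t)).
Proof.
  intros [Hsol Hmax]; split; [apply soliton_solution_translate, Hsol |].
  intros a1 b1 x1 y1 th1 Ha Hb Hsol1 Hext.
  destruct (Hmax (Rbar_minus a1 (- t)) (Rbar_minus b1 (- t))
    (fun s => x1 (s + - t)) (fun s => y1 (s + - t)) (fun s => th1 (s + - t))) as [Ha1 Hb1].
  - apply Rbar_minus_opp_le, Ha.
  - apply Rbar_le_minus_opp, Hb.
  - apply (soliton_solution_translate a1 b1 x1 y1 th1 (- t)), Hsol1.
  - intros s Hs.
    destruct (Hext (s + - t)) as (-> & -> & ->).
    + apply in_oo_translate; replace (s + - t + t) with s by ring; trivial.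
    + replace (s + - t + t) with s by ring; auto.
  - split; apply Rbar_minus_opp_cancel; trivial.
Qed.

(** * Concavity *)

(** The tangent at [v] has direction [(cos v, - sin v)], so [(sin v, cos v)] is the upward normal.
    The component of the curve along it has derivative a positive multiple of [sin (v - w)], hence
    it increases up to [v] and decreases afterwards. *)
Lemma below_tangent_line (c u0 u v : R) :
  0 < c -> - (PI / 2) < u < PI / 2 -> - (PI / 2) < v < PI / 2 ->
  cos v * (height c u - height c v) + sin v * (abscissa c u0 u - abscissa c u0 v) <= 0.
Proof.
  intros Hc Hu Hv.
  pose (F := fun w => cos v * height c w + sin v * abscissa c u0 w).
  assert (HF : forall w, is_derive F w (cos w / speed c w * sin (v - w))).
  { intros w; pose proof (speed_pos c w Hc).
    replace (cos w / speed c w * sin (v - w)) with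
      (plus (scal (cos v) (- (sin w * cos w / speed c w)))
            (scal (sin v) (cos w ^ 2 / speed c w)))
      by (rewrite sin_minus; unfold plus, scal; simpl; unfold mult; simpl; field; lra).
    apply (is_derive_plus (fun w => cos v * height c w) (fun w => sin v * abscissa c u0 w)).
    - apply (is_derive_scal (height c)), is_derive_height, Hc.
    - apply (is_derive_scal (abscissa c u0)), is_derive_abscissa, Hc. }
  assert (Hcoef : forall w, - (PI / 2) < w < PI / 2 -> 0 < cos w / speed c w).
  { intros w Hw; apply Rdiv_lt_0_compat; [apply cos_phase_pos, Hw | apply speed_pos, Hc]. }
  enough (F u <= F v) by (unfold F in *; lra).
  destruct (Rtotal_order u v) as [Huv | [-> | Huv]]; [| lra |].
  - destruct (mean_value m_infty p_infty F _ u v (fun w _ => HF w) (conj I I) (conj I I) Huv)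
      as [w [Hw Hw']].
    enough (0 <= cos w / speed c w * sin (v - w) * (v - u)) by lra.
    apply Rmult_le_pos; [apply Rmult_le_pos | lra].
    + apply Rlt_le, Hcoef; lra.
    + apply sin_ge_0; lra.
  - destruct (mean_value m_infty p_infty F _ v u (fun w _ => HF w) (conj I I) (conj I I) Huv)
      as [w [Hw Hw']].
    enough (0 <= cos w / speed c w * sin (w - v) * (u - v)).
    { replace (v - w) with (- (w - v)) in Hw by ring; rewrite sin_neg in Hw; lra. }
    apply Rmult_le_pos; [apply Rmult_le_pos | lra].
    + apply Rlt_le, Hcoef; lra.
    + apply sin_ge_0; lra.
Qed.

Lemma concave_profile (c u0 : R) (h : R -> R) : 0 < c ->
  (forall p, abscissa c u0 (- (PI / 2)) < p < abscissa c u0 (PI / 2) ->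
    - (PI / 2) < h p < PI / 2 /\ abscissa c u0 (h p) = p) ->
  concave_on (abscissa c u0 (- (PI / 2))) (abscissa c u0 (PI / 2)) (fun p => height c (h p)).
Proof.
  intros Hc Hh p q t Hp Hq Ht.
  set (r := t * p + (1 - t) * q).
  assert (Hr : abscissa c u0 (- (PI / 2)) < r < abscissa c u0 (PI / 2)).
  (* For [t = 0] the point [r] is [q]; otherwise [p] carries positive weight and the bounds on [p]
     give strictness. *)
  { unfold r; split; destruct (Req_dec t 0) as [-> | Ht0]; nra. }
  destruct (Hh p Hp) as [Hup Hxp], (Hh q Hq) as [Huq Hxq], (Hh r Hr) as [Hur Hxr].
  pose proof (below_tangent_line c u0 _ _ Hc Hup Hur) as Lp.
  pose proof (below_tangent_line c u0 _ _ Hc Huq Hur) as Lq.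
  rewrite Hxr, Hxp in Lp; rewrite Hxr, Hxq in Lq.
  pose proof (cos_phase_pos _ Hur) as Hcos.
  apply (Rmult_le_compat_l t) in Lp; [| lra].
  apply (Rmult_le_compat_l (1 - t)) in Lq; [| lra].
  apply (Rmult_le_reg_l (cos (h r))); trivial.
  (* In this form the sine terms, weighted by [t] and [1 - t], cancel when the two tangent line
     inequalities at [r] are added. *)
  replace (sin (h r) * (p - r)) with (sin (h r) * ((1 - t) * (p - q))) in Lp by (unfold r; ring).
  replace (sin (h r) * (q - r)) with (sin (h r) * (t * (q - p))) in Lq by (unfold r; ring).
  lra.
Qed.

(** * Limits of the angle and of the tangent at the ends *)

Lemma tangent_limit_of_angle (a b e : Rbar) (x y th : R -> R) (l : R) :
  soliton_solution a b x y th ->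
  filterlim (fun s => - th s) (within (in_oo a b) (Rbar_locally e)) (locally l) ->
  tangent_limit_at_end a b e x y (cos l, - sin l).
Proof.
  intros Hsol Hlim; unfold tangent_limit_at_end.
  apply (filterlim_within_ext (in_oo a b) (fun s => (cos (- th s), - sin (- th s)))).
  - intros s Hs; destruct (Hsol s Hs) as (_ & _ & Hdx & Hdy & _).
    unfold tangent; rewrite cos_neg, sin_neg, Ropp_involutive.
    f_equal; symmetry; apply is_derive_unique; trivial.
  - refine (filterlim_comp _ _ _ (fun s => - th s) (fun u => (cos u, - sin u)) _ _ _ Hlim _).
    (* Balls in the plane are products of balls here, so the limit can be taken componentwise. *)
    apply (filterlim_filter_le_2 _ (G := filter_prod (locally (cos l)) (locally (- sin l)))).
    + intros P [eps HP].
      exists (ball (cos l) eps) (ball (- sin l) eps).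
      * apply locally_ball.
      * apply locally_ball.
      * intros p q Hp Hq; apply HP; split; trivial.
    + apply filterlim_pair.
      * apply (continuity_pt_filterlim cos), continuity_cos.
      * apply (continuity_pt_filterlim (fun u => - sin u)).
        apply continuity_pt_opp, continuity_sin.
Qed.

(** The function [g] inverts the increasing [param], so [s] beyond [param c u0 u] forces [g s]
    beyond [u], for [u] as near to the end angle as desired. *)
Lemma angle_limits (c u0 : R) (g : R -> R) (A B : R) : 0 < c ->
  A = param c u0 (- (PI / 2)) -> B = param c u0 (PI / 2) ->
  (forall s, in_oo A B s -> - (PI / 2) < g s < PI / 2 /\ param c u0 (g s) = s) ->
  filterlim g (within (in_oo A B) (Rbar_locally A)) (locally (- (PI / 2))) /\
  filterlim g (within (in_oo A B) (Rbar_locally B)) (locally (PI / 2)).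
Proof.
  intros Hc HA HB Hg; pose proof PI_RGT_0 as HPI.
  assert (Hmono : forall u s, - (PI / 2) <= u <= PI / 2 -> in_oo A B s ->
    (s < param c u0 u -> g s < u) /\ (param c u0 u < s -> u < g s)).
  { intros u s Hu Hs; destruct (Hg s Hs) as [Hgs Hs'].
    rewrite <- Hs' at 1 3.
    split; intros H; apply Rnot_le_lt; intros [Hlt | Heq].
    - pose proof (param_increasing c u0 u (g s) Hc ltac:(lra) Hlt ltac:(lra)); lra.
    - rewrite <- Heq in H; lra.
    - pose proof (param_increasing c u0 (g s) u Hc ltac:(lra) Hlt ltac:(lra)); lra.
    - rewrite <- Heq in H; lra. }
  split; intros P [eps HP]; pose proof (cond_pos eps) as Heps.
  (* The cap at 0 keeps [u] in the phase interval when [eps] is large. *)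
  - set (u := Rmin (- (PI / 2) + eps) 0).
    assert (Hu : - (PI / 2) < u <= 0 /\ u <= - (PI / 2) + eps)
      by (unfold u, Rmin; destruct Rle_dec; lra).
    assert (Hd : 0 < param c u0 u - A)
      by (rewrite HA; apply Rlt_0_minus, param_increasing; lra).
    exists (mkposreal _ Hd); intros s Hball Hs.
    apply HP, Rabs_def1; unfold minus, plus, opp; simpl.
    + destruct (Hmono u s) as [Hlt _]; [lra | trivial |].
      apply Rabs_def2 in Hball; unfold minus, plus, opp in Hball; simpl in Hball.
      specialize (Hlt ltac:(lra)); lra.
    + destruct (Hg s Hs) as [Hgs _]; lra.
  - set (u := Rmax (PI / 2 - eps) 0).
    assert (Hu : 0 <= u < PI / 2 /\ PI / 2 - eps <= u)
      by (unfold u, Rmax; destruct Rle_dec; lra).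
    assert (Hd : 0 < B - param c u0 u)
      by (rewrite HB; apply Rlt_0_minus, param_increasing; lra).
    exists (mkposreal _ Hd); intros s Hball Hs.
    apply HP, Rabs_def1; unfold minus, plus, opp; simpl.
    + destruct (Hg s Hs) as [Hgs _]; lra.
    + destruct (Hmono u s) as [_ Hlt]; [lra | trivial |].
      apply Rabs_def2 in Hball; unfold minus, plus, opp in Hball; simpl in Hball.
      specialize (Hlt ltac:(lra)); lra.
Qed.

(** * The soliton as a concave graph with vertical ends *)

Theorem theorem5p8 (a b : Rbar) (x y th : R -> R) (y0 th0 : R)
  (hmax : maximal_soliton_solution a b x y th)
  (h0 : in_oo a b 0)
  (hx : x 0 = 0) (hy : y 0 = y0) (hth : th 0 = th0)
  (hy0 : 0 < y0) (hth0 : 0 < th0 < PI / 2) :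
  (exists s0 : R,
     in_oo a b s0 /\
     in_oo (Rbar_minus a s0) (Rbar_minus b s0) 0 /\
     maximal_soliton_solution (Rbar_minus a s0) (Rbar_minus b s0)
       (fun s => x (s + s0)) (fun s => y (s + s0)) (fun s => th (s + s0)) /\
     th (0 + s0) = 0) /\
  (exists (xm xM : R) (f : R -> R),
     xm < xM /\
     is_graph_over xm xM f (trace a b x y) /\
     concave_on xm xM f /\
     (exists v : R * R, vertical v /\ tangent_limit_at_end a b a x y v) /\
     (exists v : R * R, vertical v /\ tangent_limit_at_end a b b x y v)).
Proof.
  pose proof PI_RGT_0 as HPI.
  assert (Hc : 0 < first_integral y th 0) by (apply first_integral_pos; lra).
  destruct (maximal_solution_is_model a b x y th _ _ hmax h0 hx eq_refl eq_refl) as [Ha Hb].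
  assert (Hmodel : forall s, in_oo a b s -> - (PI / 2) < - th s < PI / 2 /\
    y s = height (first_integral y th 0) (- th s) /\
    param (first_integral y th 0) (- th 0) (- th s) = s /\
    abscissa (first_integral y th 0) (- th 0) (- th s) = x s).
  { intros s Hs; split.
    - destruct (proj1 hmax s Hs) as (_ & Hphase & _); lra.
    - apply (solution_is_model a b x y th _ _ s (proj1 hmax)); trivial. }
  revert Hc Ha Hb Hmodel.
  generalize (first_integral y th 0) (- th 0); intros c u0 Hc Ha Hb Hmodel.
  (* Because [a] and [b] are the values of [param] at the two end angles, every angle in between
     occurs, at the parameter [param c u0 u]. *)
  assert (Hattained : forall u, - (PI / 2) < u < PI / 2 ->
    in_oo a b (param c u0 u) /\ - th (param c u0 u) = u).
  { intros u Hu.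
    assert (Hs : in_oo a b (param c u0 u))
      by (rewrite Ha, Hb; split; apply param_increasing; lra).
    split; trivial; destruct (Hmodel _ Hs) as (Hphase & _ & Hp & _).
    apply (param_injective c u0); trivial; lra. }
  split.
  - destruct (Hattained 0 ltac:(lra)) as [Hs0 Hth0].
    exists (param c u0 0); split; [trivial | split; [| split]].
    + apply in_oo_translate; rewrite Rplus_0_l; trivial.
    + apply maximal_soliton_solution_translate, hmax.
    + rewrite Rplus_0_l; lra.
  (* Here [h p] is the reversed angle at which the curve lies over [p], so the profile is
     [height c (h p)]. *)
  - destruct (increasing_inverse (abscissa c u0) (fun w => cos w ^ 2 / speed c w)
      (- (PI / 2)) (PI / 2)) as [h Hh].
    + lra.
    + intros u; apply is_derive_abscissa, Hc.
    + intros u Hu; apply Rdiv_lt_0_compat;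
        [apply pow_lt, cos_phase_pos, Hu | apply speed_pos, Hc].
    (* The limit tangent is [(cos l, - sin l)]: [(0, 1)] at [a], where [l] is -pi/2, and [(0, -1)]
       at [b], where [l] is pi/2. *)
    + assert (Hlim : forall l e, filterlim (fun s => - th s) (within (in_oo a b) (Rbar_locally e)) (locally l) ->
        cos l = 0 -> sin l <> 0 -> exists v, vertical v /\ tangent_limit_at_end a b e x y v).
      { intros l e Hl Hcos Hsin; exists (cos l, - sin l); split.
        - split; simpl; lra.
        - apply tangent_limit_of_angle with th; [apply hmax | trivial]. }
      destruct (angle_limits c u0 (fun s => - th s) _ _ Hc eq_refl eq_refl) as [Hl Hr].
      { rewrite <- Ha, <- Hb; intros s Hs; destruct (Hmodel s Hs) as (H1 & _ & H2 & _); split; trivial. }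
      rewrite <- Ha, <- Hb in Hl, Hr.
      exists (abscissa c u0 (- (PI / 2))), (abscissa c u0 (PI / 2)), (fun p => height c (h p)).
      split; [apply abscissa_increasing; lra | split; [| split; [| split]]].
      * intros p q; split.
        -- intros (s & Hs & [= -> ->]); destruct (Hmodel s Hs) as (Hphase & -> & _ & <-).
           assert (Hp : abscissa c u0 (- (PI / 2)) < abscissa c u0 (- th s) < abscissa c u0 (PI / 2))
             by (split; apply abscissa_increasing; lra).
           split; trivial; f_equal.
           destruct (Hh _ Hp) as (Hphase' & Heq & _).
           (* Two angles with the same abscissa coincide, by strict monotonicity. *)
           destruct (Rtotal_order (- th s) (h (abscissa c u0 (- th s)))) as [Hlt | [H | Hlt]]; trivial.
           ++ apply (abscissa_increasing c u0) in Hlt; lra.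
           ++ apply (abscissa_increasing c u0) in Hlt; lra.
        -- intros [Hp ->]; destruct (Hh p Hp) as (Hphase & Heq & _).
           destruct (Hattained _ Hphase) as [Hs Hths].
           exists (param c u0 (h p)); split; trivial.
           destruct (Hmodel _ Hs) as (_ & -> & _ & <-).
           rewrite Hths, Heq; trivial.
      * apply concave_profile; trivial.
        intros p Hp; destruct (Hh p Hp) as (H1 & H2 & _); split; trivial.
      * apply (Hlim _ _ Hl); rewrite ?cos_neg, ?sin_neg, ?cos_PI2, ?sin_PI2; lra.
      * apply (Hlim _ _ Hr); rewrite ?cos_PI2, ?sin_PI2; lra.
Qed.
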